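(* Let $c\in\mathbb R$ and let $\theta$ be a real random variable with finite second moment. For each $T>0$ let $\bar z_T=\theta+c+\bar\nu_T$, where $\mathbb E[\bar\nu_T]=0$ and $\operatorname{Var}(\bar\nu_T)=T^{-1}$. For $j\in\{S,B\}$ let $\widetilde m^j$ be a random variable with finite second moment, not depending on $T$, and let $\alpha_{jT}\in\mathbb R$ be deterministic weights with $\alpha_{jT}\to 1$ as $T\to\infty$. Define the agents' posterior means $$m_T^j=\alpha_{jT}\,\bar z_T+(1-\alpha_{jT})\,\widetilde m^j,\qquad j\in\{S,B\}.$$ Then, as $T\to\infty$, $$\mathbb E\big[(m_T^S-m_T^B)^2\big]\to 0\qquad\text{and}\qquad \mathbb E\big[(m_T^j-\theta)^2\big]\to c^2\quad\text{for each } j\in\{S,B\}.$$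
   Context: Interpretation: $\bar z_T$ is the average of a public outcome stream with total precision $T$ containing a common bias $c$ that both agents omit from their models. $\widetilde m^j$ is agent $j$'s fixed finite-precision private estimate. $S$ is the pricing (seller) agent and $B$ the buying agent. *)

(* Defs.v *)
From HB Require Import structures.
From mathcomp Require Import all_boot all_order all_algebra.
From mathcomp Require Import all_classical all_reals all_analysis.

Set Implicit Arguments.
Unset Strict Implicit.
Unset Printing Implicit Defensive.

Import Order.TTheory GRing.Theory Num.Theory.
Import numFieldNormedType.Exports.

Local Open Scope ring_scope.

Variant agent := Seller | Buyer.

Definition public_average (Omega : Type) (R : realType)
    (theta : Omega -> R) (c : R) (nuT : Omega -> R) : Omega -> R :=
  fun w => theta w + c + nuT w.

Definition posterior_mean (Omega : Type) (R : realType)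
    (alpha : R) (zT : Omega -> R) (m : Omega -> R) : Omega -> R :=
  fun w => alpha * zT w + (1 - alpha) * m w.

(* The expectation is extended-real valued, so this is a genuine finiteness
   condition. *)
Definition finite_second_moment d (Omega : measurableType d) (R : realType)
    (P : probability Omega R) (X : Omega -> R) : Prop :=
  ('E_P[fun w => (X w ^+ 2)%R] < +oo)%E.

(* Main.v *)
Require Import Defs.
From HB Require Import structures.
From mathcomp Require Import all_boot all_order all_algebra.
From mathcomp Require Import all_classical all_reals all_analysis.
From mathcomp Require Import measurable_realfun ring lra.

Set Implicit Arguments.
Unset Strict Implicit.
Unset Printing Implicit Defensive.

Import Order.TTheory GRing.Theory Num.Theory.
Import numFieldNormedType.Exports.

Local Open Scope classical_set_scope.
Local Open Scope ring_scope.

(** Both limits follow from [m_T^j -> theta + c] in [L^2], which is read off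
    from [m_T^j - (theta + c) = alpha nu_T + (1 - alpha) (mtilde^j - (theta + c))].
    Only nonnegative integrands are ever compared: the triangle inequality of
    [L^2] is replaced by [(x + y)^2 <= (1 + e) x^2 + (1 + 1/e) y^2], so cross
    moments such as [E[nu_T mtilde^j]] never appear. *)

Section SecondMoment.
Context d (Omega : measurableType d) (R : realType) (P : probability Omega R).
Implicit Types X Y : Omega -> R.

(** Kept in [\bar R]: the integrand is nonnegative, so finiteness is a hypothesis to state only
    where it matters. *)
Definition second_moment X : \bar R := 'E_P[fun w => (X w ^+ 2)%R]%E.

Lemma second_moment_ge0 X : (0 <= second_moment X)%E.
Proof. by apply: expectation_ge0 => w; exact: sqr_ge0. Qed.

Let measurable_sqr X : measurable_fun setT X ->
  measurable_fun setT (fun w => (X w ^+ 2)%:E).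
Proof. by move=> mX; apply/measurable_EFinP; exact: measurable_funX. Qed.

Lemma second_moment_cst (a : R) : second_moment (cst a) = (a ^+ 2)%:E.
Proof. exact: (expectation_cst P (a ^+ 2)). Qed.

Lemma second_momentZ (a : R) X : measurable_fun setT X ->
  second_moment (fun w => a * X w) = ((a ^+ 2)%:E * second_moment X)%E.
Proof.
move=> mX; rewrite /second_moment unlock.
under eq_integral do rewrite exprMn EFinM.
rewrite ge0_integralZl_EFin ?sqr_ge0//; last exact: measurable_sqr.
by move=> w _; rewrite lee_fin sqr_ge0.
Qed.

(** Pointwise, the right-hand integrand exceeds the left-hand one by the square
    [e^-1 * (e * X w - Y w) ^+ 2]. *)
Lemma second_moment_young (e : R) X Y : 0 < e ->
  measurable_fun setT X -> measurable_fun setT Y ->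
  (second_moment (X \+ Y)%R <=
   (1 + e)%:E * second_moment X + (1 + e^-1)%:E * second_moment Y)%E.
Proof.
move=> e0 mX mY; have e1 : 0 < e^-1 by rewrite invr_gt0.
rewrite /second_moment unlock.
rewrite -ge0_integralZl_EFin//; [|by move=> w _; rewrite lee_fin sqr_ge0
  |exact: measurable_sqr|lra].
rewrite -ge0_integralZl_EFin//; [|by move=> w _; rewrite lee_fin sqr_ge0
  |exact: measurable_sqr|lra].
have mZ (k : R) (Z : Omega -> R) : measurable_fun setT Z ->
    measurable_fun setT (fun w => k%:E * (Z w ^+ 2)%:E)%E.
  by move=> mZ; apply: measurable_funeM; exact: measurable_sqr.
have pZ (k : R) (Z : Omega -> R) w : 0 < k -> (0 <= (1 + k)%:E * (Z w ^+ 2)%:E)%E.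
  by move=> k0; rewrite -EFinM lee_fin mulr_ge0 ?sqr_ge0//; lra.
rewrite -ge0_integralD//; [|by move=> w _; exact: pZ|exact: mZ
  |by move=> w _; exact: pZ|exact: mZ].
apply: ge0_le_integral => //.
- by move=> w _; rewrite lee_fin sqr_ge0.
- by apply: measurable_sqr; exact: measurable_funD.
- by apply: emeasurable_funD; exact: mZ.
move=> w _; rewrite -!EFinM -EFinD lee_fin/= -subr_ge0.
have -> : (1 + e) * X w ^+ 2 + (1 + e^-1) * Y w ^+ 2 - (X w + Y w) ^+ 2 =
    e^-1 * (e * X w - Y w) ^+ 2 by field; rewrite gt_eqF.
by rewrite mulr_ge0 ?sqr_ge0// ltW.
Qed.

Lemma second_momentD_lty X Y :
  measurable_fun setT X -> measurable_fun setT Y ->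
  (second_moment X < +oo -> second_moment Y < +oo ->
   second_moment (X \+ Y)%R < +oo)%E.
Proof.
move=> mX mY X2 Y2; apply: le_lt_trans (second_moment_young ltr01 mX mY) _.
by rewrite lte_add_pinfty// lte_mul_pinfty//= ?lee_fin ?invr1 ?addr_ge0.
Qed.

Lemma second_momentN X : second_moment (fun w => - X w) = second_moment X.
Proof. by congr expectation; apply/funext => w; rewrite sqrrN. Qed.

End SecondMoment.

Section SecondMomentLimits.
Context d (Omega : measurableType d) (R : realType) (P : probability Omega R).
Context (I : Type) (F : set_system I) (FF : ProperFilter F).
Implicit Types X Y D : I -> Omega -> R.

(** Squeezed between 0 and the Young bound with [e = 1]. *)
Lemma second_momentD_cvg0 X Y :
  (forall i, measurable_fun setT (X i)) ->
  (forall i, measurable_fun setT (Y i)) ->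
  second_moment P (X i) @[i --> F] --> 0%E ->
  second_moment P (Y i) @[i --> F] --> 0%E ->
  second_moment P (X i \+ Y i) @[i --> F] --> 0%E.
Proof.
move=> mX mY X0 Y0.
apply: (@squeeze_cvge _ _ _ _ (cst 0%E) _
  (fun i => (1 + 1)%:E * second_moment P (X i) +
            (1 + 1^-1)%:E * second_moment P (Y i))%E).
- apply: nearW => i; rewrite second_moment_ge0/=.
  exact: second_moment_young.
- exact: cvg_cst.
- rewrite -[X in _ --> X](_ : (1 + 1)%:E * 0 + (1 + 1^-1)%:E * 0 = 0 :> \bar R)%E.
    by apply: cvgeD => //; exact: cvgeZl.
  by rewrite !mule0 adde0.
Qed.

(** For the term [(1 - alpha) * Y]: a fixed variable with a vanishing weight. Finiteness turns the
    second moment into a real factor of [a i * a i]. *)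
Lemma second_momentZ_cvg0 (a : I -> R) (X : Omega -> R) :
  measurable_fun setT X -> (second_moment P X < +oo)%E ->
  a i @[i --> F] --> (0 : R) ->
  second_moment P (fun w => a i * X w) @[i --> F] --> 0%E.
Proof.
move=> mX X2 a0.
under eq_fun do rewrite second_momentZ//.
have /fineK <- : second_moment P X \is a fin_num.
  by rewrite ge0_fin_numE// second_moment_ge0.
apply: cvg_EFin; first exact: nearW.
rewrite -[X in _ --> X](mul0r (fine (second_moment P X))).
apply: cvgMl; rewrite -(mulr0 (0 : R)); exact: (cvgM a0 a0).
Qed.

(** For the term [alpha * nu]: here the variable vanishes and the weight only converges. The limit
    [l ^+ 2 * 0] is determinate because [l] is real. *)
Lemma second_momentZ_bounded_cvg0 (a : I -> R) (l : R) X :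
  (forall i, measurable_fun setT (X i)) ->
  a i @[i --> F] --> l ->
  second_moment P (X i) @[i --> F] --> 0%E ->
  second_moment P (fun w => a i * X i w) @[i --> F] --> 0%E.
Proof.
move=> mX al X0.
under eq_fun do rewrite second_momentZ//.
rewrite -(mule0 (l ^+ 2)%:E); apply: cvgeM => //.
apply: cvg_EFin; first exact: nearW.
exact: (cvgM al al).
Qed.

(** Continuity of the squared [L^2] norm. Young is applied to [X + D] and to [X = (X + D) - D],
    which bounds each second moment by the other; [e] is fixed first, then [D] is made small
    relative to it. *)
Lemma second_moment_cvg (X : Omega -> R) D :
  measurable_fun setT X -> (second_moment P X < +oo)%E ->
  (forall i, measurable_fun setT (D i)) ->
  second_moment P (D i) @[i --> F] --> 0%E ->
  second_moment P (X \+ D i) @[i --> F] --> second_moment P X.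
Proof.
move=> mX X2 mD D0.
have Xfin : second_moment P X \is a fin_num.
  by rewrite ge0_fin_numE// second_moment_ge0.
move/fine_cvgP : D0 => [Dfin D0].
have XDfin : \forall i \near F, second_moment P (X \+ D i) \is a fin_num.
  near=> i; rewrite ge0_fin_numE ?second_moment_ge0//.
  apply: second_momentD_lty => //.
  by rewrite -ge0_fin_numE ?second_moment_ge0//; near: i.
rewrite -(fineK Xfin); apply/fine_cvgP; split => //.
set x := fine (second_moment P X).
have x0 : 0 <= x by rewrite fine_ge0// second_moment_ge0.
apply/cvgrPdist_lt => eta eta0.
(* The second argument gives [e * x < eta / 4], with [x + 1] avoiding a division by zero; the bound
   by 1 absorbs the products [e * (e * x)] and [e * ((1 + e^-1) * v)] below. *)
pose e := Num.min 1 (eta / (4 * (x + 1))).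
have e0 : 0 < e by rewrite lt_min ltr01 divr_gt0//; lra.
have e1 : e <= 1 by rewrite ge_min lexx.
have ex : e * x < eta / 4.
  have : e * (x + 1) <= eta / 4.
    have -> : eta / 4 = eta / (4 * (x + 1)) * (x + 1).
      by field; rewrite gt_eqF//; lra.
    by rewrite ler_wpM2r ?ge_min ?lexx ?orbT//; lra.
  by rewrite mulrDr mulr1; lra.
have k0 : 0 < 1 + e^-1 by rewrite addr_gt0// invr_gt0.
(* This threshold keeps the Young term in [D] below [eta / 4]. *)
move/cvgrPdist_lt : D0 => /(_ (eta / 4 / (1 + e^-1))).
rewrite !divr_gt0// => /(_ isT) D0.
near=> i.
have Df : second_moment P (D i) \is a fin_num by near: i.
have XDf : second_moment P (X \+ D i) \is a fin_num by near: i.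
have : `|0 - fine (second_moment P (D i))| < eta / 4 / (1 + e^-1) by near: i.
set v := fine (second_moment P (D i)) => vi.
set y := fine (second_moment P (X \+ D i)).
have v0 : 0 <= v by rewrite fine_ge0// second_moment_ge0.
have vlt : (1 + e^-1) * v < eta / 4.
  rewrite mulrC -ltr_pdivlMr//.
  by rewrite sub0r normrN ger0_norm in vi.
have yx : y <= (1 + e) * x + (1 + e^-1) * v.
  have := second_moment_young P e0 mX (mD i).
  by rewrite -(fineK Df) -(fineK XDf) -(fineK Xfin) -!EFinM -EFinD lee_fin.
have xy : x <= (1 + e) * y + (1 + e^-1) * v.
  have mXD : measurable_fun setT (X \+ D i).
    exact: measurable_funD.
  have mND : measurable_fun setT (fun w => - D i w) by exact: measurable_funN.
  have := second_moment_young P e0 mXD mND.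
  rewrite second_momentN.
  have -> : (X \+ D i) \+ (fun w => - D i w) = X.
    by apply/funext => w /=; rewrite addrK.
  by rewrite -(fineK Df) -(fineK XDf) -(fineK Xfin) -!EFinM -EFinD lee_fin.
(* The bound [xy] has the unknown [y] on its right, so [yx] is substituted into [e * y]. Then
   [x - y] is less than four quarters of [eta], and [y - x] less than two. *)
have ey : e * y <= e * x + (eta / 4 + eta / 4).
  have : e * y <= e * ((1 + e) * x + (1 + e^-1) * v) by rewrite ler_pM2l.
  have : e * (e * x) <= e * x by rewrite ler_piMl// mulr_ge0// ltW.
  have : e * ((1 + e^-1) * v) <= (1 + e^-1) * v.
    by rewrite ler_piMl// mulr_ge0// ltW.
  lra.
by rewrite -[X in `|_ - X|]/y ltr_norml; apply/andP; split; lra.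
Unshelve. all: by end_near. Qed.

End SecondMomentLimits.

Theorem mainTheorem7 (d : measure_display) (Omega : measurableType d)
    (R : realType) (P : probability Omega R)
    (c : R) (theta : {RV P >-> R}) (nu : R -> {RV P >-> R})
    (mtilde : agent -> {RV P >-> R}) (alpha : agent -> R -> R)
    (theta2 : finite_second_moment P theta)
    (nu_mean : forall T : R, 0 < T -> 'E_P[nu T]%E = 0%E)
    (nu_var : forall T : R, 0 < T -> 'V_P[nu T]%E = (T^-1)%:E)
    (mtilde2 : forall j : agent, finite_second_moment P (mtilde j))
    (alpha1 : forall j : agent, alpha j T @[T --> +oo] --> (1 : R)) :
  let z := fun T : R => public_average theta c (nu T) in
  let m := fun (j : agent) (T : R) =>
    posterior_mean (alpha j T) (z T) (mtilde j) in
  ('E_P[fun w => ((m Seller T w - m Buyer T w) ^+ 2)%R]%E @[T --> +oo] --> 0%E) /\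
  (forall j : agent,
    'E_P[fun w => ((m j T w - theta w) ^+ 2)%R]%E @[T --> +oo] --> (c ^+ 2)%:E).
Proof.
move=> z m.
(* [D j T] is the deviation of [m j T] from the biased target [theta + c]; [Y j] is free of [T], so
   one finiteness proof serves for all [T]. *)
pose Y j := fun w => mtilde j w + - (theta w + c).
pose D j T := fun w => alpha j T * nu T w + (1 - alpha j T) * Y j w.
have mthc : measurable_fun setT (fun w => theta w + c).
  exact: measurable_funD.
have mNthc : measurable_fun setT (fun w => - (theta w + c)).
  exact: measurable_funN.
have mY j : measurable_fun setT (Y j) by exact: measurable_funD.
have mD j T : measurable_fun setT (D j T).
  by apply: measurable_funD; exact: measurable_funM.
have Y2 j : (second_moment P (Y j) < +oo)%E.
  apply: (second_momentD_lty _ _ (mtilde2 j)) => //.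
  rewrite second_momentN.
  apply: (second_momentD_lty _ (measurable_cst c) theta2) => //.
  by rewrite second_moment_cst ltry.
have nu0 : second_moment P (nu T) @[T --> +oo] --> 0%E.
  have : (T^-1)%:E @[T --> +oo] --> (0 : R)%:E.
    apply: cvg_EFin; first exact: nearW.
    by apply/gtr0_cvgV0; [exact: nbhs_pinfty_gt|exact: cvg_id].
  (* The moment hypotheses on [nu T] hold for [0 < T] only, hence an eventual equality: with mean
     zero, the variance is the second moment. *)
  apply: cvg_trans; apply: near_eq_cvg.
  near=> T; have T0 : 0 < T by near: T; exact: nbhs_pinfty_gt.
  rewrite -(nu_var T T0) /variance unlock /= nu_mean//=.
  by congr expectation; apply/funext => w; rewrite !fctE /= !subr0 expr2.
have D0 j : second_moment P (D j T) @[T --> +oo] --> 0%E.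
  apply: second_momentD_cvg0.
  - by move=> T; exact: measurable_funM.
  - by move=> T; exact: measurable_funM.
  - exact: (second_momentZ_bounded_cvg0 _ _ (alpha1 j)).
  - apply: second_momentZ_cvg0 => //.
    by rewrite -(subrr (1 : R)); apply: cvgB => //; exact: cvg_cst.
split=> [|j].
(* The common target [theta + c] cancels, bias included. *)
- have -> : (fun T => 'E_P[fun w => ((m Seller T w - m Buyer T w) ^+ 2)%R]%E) =
      (fun T => second_moment P (D Seller T \+ (fun w => - D Buyer T w))).
    apply/funext => T; congr expectation; apply/funext => w.
    rewrite /m /z /posterior_mean /public_average /D /Y /=; ring.
  apply: second_momentD_cvg0 => //.
  + by move=> T; apply: measurable_funN; exact: mD.
  + by under eq_fun do rewrite second_momentN; exact: D0.
(* Measured against [theta] alone, the bias survives as the constant [c], whose second moment is the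
   limit. *)
- have -> : (fun T => 'E_P[fun w => ((m j T w - theta w) ^+ 2)%R]%E) =
      (fun T => second_moment P (cst c \+ D j T)).
    apply/funext => T; congr expectation; apply/funext => w.
    rewrite /m /z /posterior_mean /public_average /D /Y /=; ring.
  rewrite -(second_moment_cst P c).
  apply: second_moment_cvg => //.
  by rewrite second_moment_cst ltry.
Unshelve. all: by end_near. Qed.
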